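(* For $m\in\mathbb{N}$, let $(X_1,\mu_{X_1}),\dots,(X_m,\mu_{X_m})$ be Polish measure spaces and let $c:X_1\times\cdots\times X_m\to(-\infty,\infty)$ be a continuous function. Fix $\lambda_1,\dots,\lambda_m\in(0,1)$ with $\sum_{i=1}^m\lambda_i=1$. For $i=1,\dots,m$ let $\mathcal{C}_{X_i}$ be a collection of $\mu_{X_i}$-measurable subsets of $X_i$. Let $a,b\in\mathbb{R}\cup\{\pm\infty\}$ be such that for all non-empty $A_i\in\mathcal{C}_{X_i}$ $(1\le i\le m)$ one has $\sup_{x_i\in A_i,\,1\le i\le m}-c(x_1,\dots,x_m)\in[a,b]$, and let $F:(a,b]\to[0,\infty)$ be a continuous, non-decreasing function with $F(a^+)=\lim_{r\to a^+}F(r)=0$. Then the following are equivalent: (1) For all non-empty $A_1\in\mathcal{C}_{X_1},\dots,A_m\in\mathcal{C}_{X_m}$, $$\prod_{i=1}^m\mu_{X_i}(A_i)^{\lambda_i}\le F\Big(\sup_{x_i\in A_i,\,1\le i\le m}-c(x_1,\dots,x_m)\Big).$$ (2) For all measurable functions $f_1\in\mathcal{F}(\mathcal{C}_{X_1}),\dots,f_m\in\mathcal{F}(\mathcal{C}_{X_m})$ and every measurable non-increasing $\Omega:(a,b]\to[0,\infty)$ satisfying $$\prod_{i=1}^m f_i(x_i)^{\lambda_i}\le\Omega(-c(x_1,\dots,x_m))$$ for all $(x_1,\dots,x_m)\in X_1\times\cdots\times X_m$ with $-c(x_1,\dots,x_m)\in(a,b]$, one has $$\prod_{i=1}^m\B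ig(\int_{X_i}f_i\,d\mu_{X_i}\Big)^{\lambda_i}\le\int_a^b\Omega(r)\,dF(r).$$
   Context: A Polish measure space is a complete separable metric space equipped with a Borel measure; ''measurable'' means Borel measurable. For a collection $\mathcal{C}$ of measurable subsets of $(X,\mu)$, $\mathcal{F}(\mathcal{C})$ is the set of measurable $f:X\to[0,\infty)$ such that $\{f\ge r\}\in\mathcal{C}$ for almost every $r\in(0,\|f\|_\infty)$. $dF$ denotes the Lebesgue–Stieltjes measure on $(a,b]$ induced by $F$, so $F(t)=\int_a^t dF(r)$. Conventions: when $b=\infty$ the interval $(a,b]$ means $(a,\infty)$, and similarly for intervals with $a=-\infty$; $0\cdot\infty=0$; $F$ is extended by $F(a):=0$ and, when $b=\infty$, $F(\infty):=\lim_{r\to\infty}F(r)\in[0,\infty]$ (the supremum in (1) may be $+\infty$ in that case). *)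

(* Defs.v *)
From HB Require Import structures.
From mathcomp Require Import all_boot all_order all_algebra.
From mathcomp Require Import all_classical all_reals all_analysis.
Import Order.TTheory GRing.Theory Num.Theory.
Import numFieldNormedType.Exports.

Set Implicit Arguments.
Unset Strict Implicit.
Unset Printing Implicit Defensive.

Local Open Scope classical_set_scope.
Local Open Scope ring_scope.

Definition separable (T : topologicalType) : Prop :=
  exists2 S : set T, countable S & dense S.

HB.mixin Record isSeparable T of Topological T := {
  separable_subproof : separable T
}.

(* The distance itself is part of the structure.  [Complete] includes
   [Pointed], as does every measurable type of the library, so that these
   spaces are non-empty. *)
#[short(type="polishMetricType")]
HB.structure Definition PolishMetric (R : numDomainType) :=
  {T of Complete T & Metric R T & isSeparable T}.

Notation borelType T := (g_sigma_algebraType (@open T)).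

(* The class F(C); the norm is the mu-essential supremum, possibly +oo. *)
Definition level_class d (T : measurableType d) (R : realType)
    (mu : {measure set T -> \bar R}) (C : set (set T)) : set (T -> R) :=
  [set f : T -> R | [/\ measurable_fun setT f,
               forall x, 0 <= f x &
               \forall r \ae (@lebesgue_measure R), 0 < r ->
                 (r%:E < 'N[mu]_+oo [EFin \o f])%E -> C [set x | r <= f x]]].

Definition sup_neg (R : realType) (m : nat) (X : 'I_m -> polishMetricType R)
    (c : prod_topology X -> R) (A : forall i, set (X i)) : \bar R :=
  ereal_sup [set (- c x)%:E | x in [set x | forall i, A i (x i)]].

(* The real points of (a, b]; in particular (a, +oo) when b = +oo. *)
Definition oc_itv (R : realType) (a b : \bar R) : set R :=
  [set r | (a < r%:E <= b)%E].

(* Only the values of F on (a, b] are constrained.  The last field is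
   F(a^+) = 0, uniformly in the cases a finite and a = -oo. *)
Record stieltjes_fun (R : realType) (a b : \bar R) (F : R -> R) : Prop := {
  stieltjes_continuous : {within oc_itv a b, continuous F} ;
  stieltjes_nondecreasing :
    {in oc_itv a b &, {homo F : r s / r <= s}} ;
  stieltjes_ge0 : forall r, oc_itv a b r -> 0 <= F r ;
  stieltjes_vanish :
    F (fine s) @[s --> within [set s | (a < s <= b)%E] (nbhs a)] --> (0 : R)
}.

(* F extended by F(a) := 0 and F(+oo) := lim_{r -> +oo} F(r); meant to be used
   on [a, b]. *)
Definition stieltjes_ext (R : realType) (a : \bar R) (F : R -> R)
    (s : \bar R) : \bar R :=
  (if s <= a then 0 else
   match s with
   | r%:E => (F r)%:E
   | +oo => lim ((F r)%:E @[r --> +oo%R])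
   | -oo => 0
   end)%E.

(* F extended to the whole real line, by 0 below a and by F(b) above b. *)
Definition stieltjes_cdf (R : realType) (a b : \bar R) (F : R -> R)
    (hF : stieltjes_fun a b F) (r : R) : R :=
  fine (stieltjes_ext a F (mine r%:E b)).

Section stieltjes_cdf.
Context (R : realType) (a b : \bar R) (F : R -> R) (hF : stieltjes_fun a b F).

Let near_right_le (r : R) (e : \bar R) :
  (r%:E < e)%E -> \forall s \near r^'+, (s%:E <= e)%E.
Proof.
case: e => [e| |]//= re; last by near=> s; rewrite leey.
near=> s; rewrite lee_fin; near: s; apply: nbhs_right_le.
by rewrite lte_fin in re.
Unshelve. all: by end_near. Qed.

Let cdf_low r : (mine r%:E b <= a)%E -> stieltjes_cdf hF r = 0.
Proof. by rewrite /stieltjes_cdf /stieltjes_ext => ->. Qed.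

Let cdf_high r : (a < mine r%:E b)%E -> exists q, [/\ mine r%:E b = q%:E,
  oc_itv a b q & stieltjes_cdf hF r = F q].
Proof.
move=> h.
have hr : (mine r%:E b <= r%:E)%E by rewrite ge_min lexx.
have hb : (mine r%:E b <= b)%E by rewrite ge_min lexx orbT.
rewrite /stieltjes_cdf /stieltjes_ext leNgt h /=.
move: h hr hb; case: (mine _ _) => [q| |] h hr hb.
- by exists q; rewrite /oc_itv/= h hb.
- by rewrite leye_eq in hr.
- by rewrite ltNge leNye in h.
Qed.

Let cdf_nondecreasing : nondecreasing (stieltjes_cdf hF).
Proof.
move=> r s rs.
have mrs : (mine r%:E b <= mine s%:E b)%E.
  by rewrite le_min !ge_min lee_fin rs lexx orbT.
have [ha|ha] := leP (mine r%:E b) a.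
  rewrite (cdf_low ha).
  have [hs|/cdf_high[q [_ qab ->]]] := leP (mine s%:E b) a.
    by rewrite (cdf_low hs).
  exact: (stieltjes_ge0 hF).
have /cdf_high[q' [eq' q'ab ->]] := lt_le_trans ha mrs.
have [q [eq qab ->]] := cdf_high ha.
apply: (stieltjes_nondecreasing hF); rewrite ?inE//.
by move: mrs; rewrite eq eq' lee_fin.
Qed.

Let cdf_right_continuous : right_continuous (stieltjes_cdf hF).
Proof.
move=> r.
have [br|rb] := leP b r%:E.
  apply: cvg_near_cst; near=> s.
  have rs : r <= s by near: s; exact: nbhs_right_ge.
  rewrite /stieltjes_cdf !min_r//.
  by rewrite (le_trans br)// lee_fin.
have {}minr s : s%:E \in [set x : \bar R | (x <= b)%E] ->
    mine s%:E b = s%:E.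
  by rewrite inE/= => sb; rewrite min_l.
have nb : \forall s \near r^'+, (s%:E <= b)%E.
  exact: near_right_le.
have [ra|ar] := ltP r%:E a.
  have na : \forall s \near r^'+, (s%:E <= a)%E.
    exact: near_right_le.
  apply: cvg_near_cst; near=> s.
  rewrite !cdf_low//; first by rewrite ge_min (ltW ra).
  by rewrite ge_min; apply/orP; left; near: s.
have cdfE s : (a < s%:E)%E -> (s%:E <= b)%E -> stieltjes_cdf hF s = F s.
  move=> sa sb.
  have : (a < mine s%:E b)%E by rewrite minr// inE.
  by move=> /cdf_high[q []]; rewrite minr ?inE// => -[->].
have [arE|rNa] := eqVneq a r%:E.
  rewrite (_ : stieltjes_cdf hF r = 0); last first.
    by rewrite cdf_low// arE ge_min lexx.
  apply/cvgrPdist_lt => e e0.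
  have H : \forall s \near r, (r%:E < s%:E <= b)%E -> `|0 - F s| < e.
    have /cvgrPdist_lt/(_ e e0) := stieltjes_vanish hF.
    rewrite {1 2}arE near_withinE => H; exact: H.
  near=> s.
  have rs : r < s by near: s; exact: nbhs_right_gt.
  have sb : (s%:E <= b)%E by near: s.
  rewrite cdfE// ?arE ?lte_fin//.
  suff : (r%:E < s%:E <= b)%E -> `|0 - F s| < e by apply; rewrite lte_fin rs sb.
  by near: s; exact: cvg_within.
have {rNa}ar : (a < r%:E)%E by rewrite lt_neqAle rNa.
rewrite cdfE ?(ltW rb)//.
have rab : oc_itv a b r by rewrite /oc_itv/= ar ltW.
have /subspace_continuousP/(_ r rab)/= Fr := stieltjes_continuous hF.
apply/cvgrPdist_lt => e e0.
have H : \forall s \near r, oc_itv a b s -> `|F r - F s| < e.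
  by have /cvgrPdist_lt/(_ e e0) := Fr; rewrite near_withinE.
near=> s.
have rs : r < s by near: s; exact: nbhs_right_gt.
have sa : (a < s%:E)%E by rewrite (lt_trans ar)// lte_fin.
have sb : (s%:E <= b)%E by near: s.
rewrite cdfE//.
suff : oc_itv a b s -> `|F r - F s| < e by apply; rewrite /oc_itv/= sa.
by near: s; exact: cvg_within.
Unshelve. all: by end_near. Qed.

HB.instance Definition _ := isCumulative.Build R _ R (stieltjes_cdf hF)
  cdf_nondecreasing cdf_right_continuous.

(* The measure dF; only its restriction to (a, b] is used. *)
Definition stieltjes_measure := lebesgue_stieltjes_measure (stieltjes_cdf hF).
HB.instance Definition _ := Measure.on stieltjes_measure.

End stieltjes_cdf.

(* Main.v *)
(* Slicing the f_i at levels t_i turns the geometric inequality (1) into the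
   one-dimensional inequality
     prod_i mu_i {f_i >= t_i}^lambda_i <= dF {Omega >= theta prod_i t_i^lambda_i}
   for every theta < 1.  It is then integrated as in the transport proof of the
   multiplicative Prekopa-Leindler inequality, but discretely: cut each range
   [0, U_i] at points u_i^k along which the truncated integrals of f_i increase
   by the same amount y_i / n, put z^k = prod_i (u_i^k)^lambda_i, and bound the
   integral of Omega below by a lower sum along the levels z^k.  Superadditivity
   of the geometric mean, z^(k+1) - z^k >= prod_i (u_i^(k+1) - u_i^k)^lambda_i,
   yields prod_i y_i^lambda_i up to a relative error O(1/n). *)
Require Import Defs.
From mathcomp Require Import all_boot all_order all_algebra.
From mathcomp Require Import all_classical all_reals all_analysis.
From mathcomp Require Import measurable_realfun ess_sup_inf ring lra.
Import Order.TTheory GRing.Theory Num.Theory.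
Import numFieldNormedType.Exports.

Set Implicit Arguments.
Unset Strict Implicit.

Local Open Scope classical_set_scope.
Local Open Scope ring_scope.

(** * Weighted geometric means *)

Lemma ln_le_subr1 (R : realType) (x : R) : 0 < x -> ln x <= x - 1.
Proof.
by move=> x0; have := @le_ln1Dx R (x - 1); rewrite subrKC; apply; lra.
Qed.

Lemma ln_prod_powR (R : realType) (I : finType) (l x : I -> R) :
  (forall i, 0 < x i) ->
  ln (\prod_i x i `^ l i) = \sum_i l i * ln (x i).
Proof.
move=> x0; rewrite -[RHS]expRK expR_sum; congr ln.
by apply: eq_bigr => i _; rewrite /powR gt_eqF.
Qed.

Lemma prod_powR_gt0 (R : realType) (I : finType) (l x : I -> R) :
  (forall i, 0 < x i) -> 0 < \prod_i x i `^ l i.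
Proof. by move=> x0; apply: prodr_gt0 => i _; rewrite powR_gt0. Qed.

Lemma prod_powR_ge0 (R : realType) (I : finType) (l x : I -> R) :
  0 <= \prod_i x i `^ l i.
Proof. by apply: prodr_ge0 => i _; rewrite powR_ge0. Qed.

Lemma prod_powR_eq0 (R : realType) (I : finType) (l x : I -> R) i :
  l i != 0 -> x i = 0 -> \prod_i x i `^ l i = 0.
Proof. by move=> li xi; rewrite (bigD1 i)//= xi powR0// mul0r. Qed.

Lemma ler_prod_powR (R : realType) (I : finType) (l x y : I -> R) :
  (forall i, 0 <= l i) -> (forall i, 0 <= x i <= y i) ->
  \prod_i x i `^ l i <= \prod_i y i `^ l i.
Proof.
move=> l0 xy; apply: ler_prod => i _; have /andP[x0 xyi] := xy i.
by rewrite powR_ge0/= ge0_ler_powR ?nnegrE// (le_trans x0).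
Qed.

Lemma prod_powRM (R : realType) (I : finType) (l x y : I -> R) :
  (forall i, 0 <= x i) -> (forall i, 0 <= y i) ->
  \prod_i (x i * y i) `^ l i = (\prod_i x i `^ l i) * (\prod_i y i `^ l i).
Proof.
by move=> x0 y0; rewrite -big_split/=; apply: eq_bigr => i _; rewrite powRM.
Qed.

Lemma prod_powR_cst (R : realType) (I : finType) (l : I -> R) (c : R) :
  0 < c -> \sum_i l i = 1 -> \prod_i c `^ l i = c.
Proof.
move=> c0 l1; rewrite -[RHS](powRr1 (ltW c0)) -l1.
elim/big_ind2 : _ => [|x1 x2 y1 y2 -> ->|//]; first by rewrite powRr0.
by rewrite powRD// (gt_eqF c0) implybT.
Qed.

(** Sum [ln z <= z - 1] at [z = x i / G], where [G] is the geometric mean: the weighted logarithms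
    cancel, leaving [0 <= (sum of l i * x i) / G - 1]. A vanishing [x i] is treated apart. *)
Lemma weighted_AMGM (R : realType) (I : finType) (l x : I -> R) :
  (forall i, 0 < l i) -> \sum_i l i = 1 -> (forall i, 0 <= x i) ->
  \prod_i x i `^ l i <= \sum_i l i * x i.
Proof.
move=> l0 l1 x0.
have [/existsP[i /eqP xi]|/existsPn xN] := boolP [exists i, x i == 0].
  rewrite (@prod_powR_eq0 _ _ _ _ i) ?gt_eqF//.
  by apply: sumr_ge0 => j _; rewrite mulr_ge0// ltW.
have {xN x0}x0 i : 0 < x i by rewrite lt_neqAle eq_sym xN x0.
set G := \prod_i _; have G0 : 0 < G by exact: prod_powR_gt0.
have : \sum_i l i * ln (x i / G) <= \sum_i l i * (x i / G - 1).
  by apply: ler_sum => i _; rewrite ler_pM2l// ln_le_subr1// divr_gt0.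
under eq_bigr do rewrite ln_div ?posrE// mulrBr.
under [X in _ <= X]eq_bigr do rewrite mulrBr mulr1 mulrA.
rewrite !sumrB -ln_prod_powR// -!mulr_suml l1 mul1r subrr subr_ge0.
by rewrite ler_pdivlMr// mul1r.
Qed.

(** Dividing by the right-hand side turns the two terms into geometric means of [x i / (x i + y i)]
    and [y i / (x i + y i)]; by AM-GM their sum is at most the sum of the weights. *)
Lemma geometric_mean_superadditive (R : realType) (I : finType)
    (l x y : I -> R) :
  (forall i, 0 < l i) -> \sum_i l i = 1 ->
  (forall i, 0 <= x i) -> (forall i, 0 < y i) ->
  \prod_i x i `^ l i + \prod_i y i `^ l i <= \prod_i (x i + y i) `^ l i.
Proof.
move=> l0 l1 x0 y0.
have z0 i : 0 < x i + y i by rewrite ltr_wpDl.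
have split t : (forall i, 0 <= t i) -> \prod_i t i `^ l i =
    (\prod_i (t i / (x i + y i)) `^ l i) * \prod_i (x i + y i) `^ l i.
  move=> t0; rewrite -prod_powRM// => [|i|i]; last exact: ltW.
    by apply: eq_bigr => i _; rewrite divfK// gt_eqF.
  by rewrite divr_ge0// ltW.
rewrite (split x)// (split y) => [|i]; last exact: ltW.
rewrite -mulrDl ler_piMl ?prod_powR_ge0//.
apply: (@le_trans _ _ (\sum_i l i * (x i / (x i + y i)) +
                       \sum_i l i * (y i / (x i + y i)))).
  by apply: lerD; apply: weighted_AMGM => // i; rewrite divr_ge0// ltW.
rewrite -big_split/= -l1; apply: ler_sum => i _.
by rewrite -mulrDr -mulrDl divff ?mulr1// gt_eqF.
Qed.

(** * Partitions and the discrete one-dimensional inequality *)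

Lemma sum_ratio_ge (R : realType) (P : nat -> R) (n : nat) :
  (forall k, (k <= n)%N -> 0 < P k) ->
  n%:R + (ln (P n) - ln (P 0%N)) <= \sum_(0 <= k < n) P k.+1 / P k.
Proof.
elim: n => [|n ih] P0; first by rewrite big_geq// subrr addr0.
rewrite big_nat_recr//=.
have {}ih := ih (fun k kn => P0 k (leqW kn)).
have Pn : 0 < P n by exact: P0.
have Pn1 : 0 < P n.+1 by exact: P0.
(* Each ratio is at least 1 plus its logarithm, and the logarithms telescope. *)
have := @ln_le_subr1 R (P n.+1 / P n) (divr_gt0 Pn1 Pn).
by rewrite ln_div ?posrE// -natr1; lra.
Qed.

Lemma lower_sum_le (R : realType) (w : nat -> R) (v : R) (n : nat) :
  0 <= w 0%N -> (forall k, (k < n)%N -> w k <= w k.+1) -> 0 <= v ->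
  \sum_(0 <= k < n) (w k.+1 - w k) * (w k.+1 <= v)%R%:R <= v.
Proof.
move=> w0 wm v0.
(* The second bound carries the induction: when [w n.+1 <= v], the sum up to [n] is at most [w n],
   so adding the next increment gives at most [w n.+1 <= v]. *)
suff : \sum_(0 <= k < n) (w k.+1 - w k) * (w k.+1 <= v)%R%:R <= v /\
    \sum_(0 <= k < n) (w k.+1 - w k) * (w k.+1 <= v)%R%:R <= w n by case.
elim: n wm => [|n ih] wm; first by rewrite big_geq.
have [ih1 ih2] := ih (fun k kn => wm k (ltnW kn)).
have wn : w n <= w n.+1 by exact: wm.
by rewrite big_nat_recr//=; have [h|h] := leP (w n.+1) v;
  rewrite /= ?mulr1 ?mulr0; split; lra.
Qed.

(* A discrete one-dimensional multiplicative Prekopa-Leindler inequality. *)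
Lemma prod_le_of_partition (R : realType) (I : finType) (l y : I -> R)
    (phi : I -> R -> R) (d K : I -> R) (J : R) :
  (forall i, 0 < l i) -> \sum_i l i = 1 -> (forall i, 0 < y i) ->
  (forall i, 0 < d i) ->
  (forall i n, (0 < n)%N -> exists u : nat -> R, [/\ u 0%N = 0,
    forall k, (k < n)%N -> y i / n%:R <= (u k.+1 - u k) * phi i (u k) &
    forall k, (k <= n)%N -> d i <= phi i (u k) <= K i]) ->
  (forall n (u : nat -> I -> R), (forall i, u 0%N i = 0) ->
    (forall i k, (k < n)%N -> u k i < u k.+1 i) ->
    (forall i k, (k <= n)%N -> 0 < phi i (u k i)) ->
    \sum_(0 <= k < n) (\prod_i u k.+1 i `^ l i - \prod_i u k i `^ l i) *
       \prod_i phi i (u k.+1 i) `^ l i <= J) ->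
  \prod_i y i `^ l i <= J.
Proof.
move=> l0 l1 y0 d0 part sumJ.
set Y := \prod_i _; have Y0 : 0 < Y by exact: prod_powR_gt0.
pose L := \prod_i K i `^ l i / \prod_i d i `^ l i.
(* [L] does not depend on [n], so the relative error [ln L / n] disappears in the limit. *)
suff H n : (0 < n)%N -> Y * (1 - ln L * n%:R^-1) <= J.
  suff : Y * (1 - ln L * 0) <= J by rewrite mulr0 subr0 mulr1.
  apply: (@cvgr_to_le _ \oo _ _ (fun n => Y * (1 - ln L * harmonic n))).
    apply: cvgM; first exact: cvg_cst.
    apply: cvgB; first exact: cvg_cst.
    by apply: cvgM; [exact: cvg_cst|exact: cvg_harmonic].
  by apply: nearW => n; exact: H.
move=> n0; have nR0 : 0 < n%:R :> R by rewrite ltr0n.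
pose u := fun i => projT1 (cid (part i n n0)).
have u0 i : u i 0%N = 0 by rewrite /u; case: cid => ? [].
have uy i k : (k < n)%N ->
    y i / n%:R <= (u i k.+1 - u i k) * phi i (u i k).
  by rewrite /u; case: cid => ? []/= _ + _; exact.
have ud i k : (k <= n)%N -> d i <= phi i (u i k) <= K i.
  by rewrite /u; case: cid => ? []/= _ _; exact.
have phi0 i k : (k <= n)%N -> 0 < phi i (u i k).
  by move=> /(ud i) /andP[+ _]; exact: lt_le_trans.
have ulty i k : (k < n)%N -> u i k < u i k.+1.
  move=> kn; rewrite -subr_gt0 -(pmulr_lgt0 _ (phi0 i k (ltnW kn))).
  by rewrite (lt_le_trans _ (uy i k kn))// divr_gt0.
have u_ge0 i k : (k <= n)%N -> 0 <= u i k.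
  elim: k => [_|k ih kn]; first by rewrite u0.
  by rewrite (le_trans (ih (ltnW kn)))// ltW// ulty.
apply: le_trans (sumJ n (fun k i => u i k) u0 ulty phi0).
pose P k := \prod_i phi i (u i k) `^ l i.
have P0 k : (k <= n)%N -> 0 < P k.
  by move=> kn; apply: prod_powR_gt0 => i; exact: phi0.
(* The partition controls the increments through phi (u k), hence P k, whereas
   the lower sum carries P k.+1; since ln P varies by at most ln L along the
   partition, the mean of the ratios P k.+1 / P k tends to 1 with n. *)
apply: (@le_trans _ _ (\sum_(0 <= k < n) Y / n%:R * (P k.+1 / P k))).
  rewrite -mulr_sumr -mulrA ler_pM2l//.
  rewrite [leRHS]mulrC ler_pdivlMr// mulrBl mul1r divfK ?gt_eqF//.
  apply: (le_trans _ (@sum_ratio_ge _ P n _)); last by move=> k /P0.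
  have K0 i : 0 < K i.
    by have /andP[h1 h2] := ud i 0%N isT;
      rewrite (lt_le_trans (d0 i))// (le_trans h1).
  rewrite ln_div ?posrE ?prod_powR_gt0// lerD2l opprB lerB//.
    rewrite ler_ln ?posrE ?prod_powR_gt0//; last by move=> i; exact: phi0.
    apply: ler_prod_powR => i; first exact: ltW.
    by have /andP[-> _] := ud i n (leqnn n); rewrite ltW.
  rewrite ler_ln ?posrE ?prod_powR_gt0//; last by move=> i; exact: phi0.
  apply: ler_prod_powR => i; first exact: ltW.
  by have /andP[_ ->] := ud i 0%N (leq0n n); rewrite ltW// phi0.
rewrite !big_nat; apply: ler_sum => k /andP[_ kn].
rewrite -/(P k.+1) mulrCA mulrC ler_pM2r ?P0//.
rewrite ler_pdivrMr ?P0 1?ltnW//.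
have duk i : 0 < u i k.+1 - u i k by rewrite subr_gt0 ulty.
(* Take the product of [y i / n <= (u i k.+1 - u i k) * phi i (u i k)], then bound the product of
   the increments by superadditivity. *)
apply: (@le_trans _ _ ((\prod_i (u i k.+1 - u i k) `^ l i) * P k)).
  rewrite /P -prod_powRM => [|i|i]; last 2 first.
    exact: ltW.
    exact/ltW/phi0/ltnW.
  have -> : Y / n%:R = \prod_i (y i / n%:R) `^ l i.
    rewrite prod_powRM; first by rewrite prod_powR_cst// invr_gt0.
      by move=> i; exact: ltW.
    by move=> i; rewrite invr_ge0 ltW.
  apply: ler_prod_powR => i; first exact: ltW.
  by rewrite uy// andbT divr_ge0 ?ltW.
rewrite ler_pM2r ?P0 1?ltnW// lerBrDl.
have -> : \prod_i u i k.+1 `^ l i =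
    \prod_i (u i k + (u i k.+1 - u i k)) `^ l i.
  by apply: eq_bigr => i _; rewrite subrKC.
by apply: geometric_mean_superadditive => // i; exact/u_ge0/ltnW.
Qed.

(** [Phi] is Lipschitz, hence continuous, so the values [k * y / n] are attained at points of some
    [[0, U]] with [Phi U = y]. The bound [d] is chosen before [n], as the limit in [n] demands. *)
Lemma equal_increment_partition (R : realType) (Phi phi : R -> R) (M y : R) :
  0 < y -> 0 <= M -> Phi 0 = 0 -> y < Phi M ->
  (forall u v : R, 0 <= u <= v -> 0 <= Phi v - Phi u <= (v - u) * phi u) ->
  (forall u v : R, 0 <= u <= v -> phi v <= phi u) ->
  exists2 d : R, 0 < d & forall n, (0 < n)%N -> exists u : nat -> R,
    [/\ u 0%N = 0,
      forall k, (k < n)%N -> y / n%:R <= (u k.+1 - u k) * phi (u k) &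
      forall k, (k <= n)%N -> d <= phi (u k) <= phi 0].
Proof.
move=> y0 M0 Phi0 yM dPhi phim.
have phi_ge0 u : 0 <= u -> 0 <= phi u.
  move=> u0; have /dPhi /andP[h1 h2] : 0 <= u <= u + 1 by rewrite u0 lerDl ler01.
  by move: (le_trans h1 h2); rewrite addrAC subrr add0r mul1r.
(* The constant [phi 0 + 1], unlike [phi 0], is known to be positive and can be divided by. *)
have lip u v : 0 <= u -> 0 <= v -> `|Phi u - Phi v| <= (phi 0 + 1) * `|u - v|.
  move=> u0 v0; wlog uv : u v u0 v0 / u <= v => [H|].
    have [/H|/ltW/H] := leP u v; first exact.
    by rewrite distrC (distrC u); exact.
  have /dPhi /andP[h1 h2] : 0 <= u <= v by rewrite u0.
  have vu : 0 <= v - u by rewrite subr_ge0.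
  rewrite distrC (distrC u) (ger0_norm h1) (ger0_norm vu) (le_trans h2)//.
  rewrite mulrC ler_wpM2r// (le_trans (phim 0 u _)) ?lexx//.
  by rewrite lerDl.
have ivt N v : 0 <= N -> 0 <= v <= Phi N -> exists2 u, 0 <= u <= N & Phi u = v.
  move=> N0 /andP[v0 vN].
  have cPhi : {within `[0, N], continuous Phi}.
    apply/subspace_continuousP => x; rewrite /= in_itv/= => /andP[x0 xN].
    have K0 : 0 < phi 0 + 1 by have := phi_ge0 0 (lexx 0); lra.
    apply/cvgrPdist_lt => e e0; rewrite near_withinE; near=> z.
    rewrite /= in_itv/= => /andP[z0 zN].
    apply: le_lt_trans (lip _ _ x0 z0) _.
    rewrite -ltr_pdivlMl// mulrC; near: z; apply/nbhs_ballP.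
    by exists (e / (phi 0 + 1)) => //=; exact: divr_gt0.
  have := @IVT _ Phi 0 N v N0 cPhi.
  rewrite Phi0 min_l ?max_r ?v0 ?vN; [|exact: le_trans v0 vN..].
  by move=> /(_ isT)[u]; rewrite in_itv/= => ? ?; exists u.
have [U /andP[U0 UM] PhiU] : exists2 u, 0 <= u <= M & Phi u = y.
  by apply: ivt => //; rewrite !ltW.
(* The strict bound [y < Phi M] gives [0 < Phi M - Phi U <= (M - U) * phi U], whence [phi U] is
   positive. *)
exists (phi U).
  have /dPhi /andP[_] : 0 <= U <= M by rewrite U0.
  have : 0 <= M - U by rewrite subr_ge0.
  have := phi_ge0 U U0; rewrite PhiU le_eqVlt => /predU1P[<-|//].
  by rewrite mulr0; lra.
move=> n n0; have nR : 0 < n%:R :> R by rewrite ltr0n.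
pose w k := k%:R * y / n%:R.
have wU k : (k <= n)%N -> 0 <= w k <= Phi U.
  move=> kn; have wk0 : 0 <= w k by rewrite divr_ge0// mulr_ge0// ltW.
  by rewrite wk0 PhiU/= ler_pdivrMr// mulrC ler_pM2l// ler_nat.
have /choice[u Hu] : forall k, exists u : R, (k <= n)%N ->
    [/\ 0 <= u <= U, Phi u = w k & k = 0%N -> u = 0].
  (* Beyond [n] the value is a dummy. At [k = 0] the point 0 is imposed, since [Phi] may have other
     zeros. *)
  move=> k; have [kn|kn] := leqP k n; last by exists 0.
  have [k0|k0] := eqVneq k 0%N.
    by exists 0 => _; rewrite lexx U0 Phi0 /w k0 !mul0r.
  have [v vU vw] := ivt U (w k) U0 (wU k kn).
  by exists v => _; split => // k0'; rewrite k0' eqxx in k0.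
exists u; split.
- by have [_ _] := Hu 0%N isT; exact.
- move=> k kn; have [/andP[u0 _] uw _] := Hu k (ltnW kn).
  have [/andP[v0 _] vw _] := Hu k.+1 kn.
  have wk : w k.+1 - w k = y / n%:R by rewrite /w -natr1; ring.
  have yn : 0 < y / n%:R by rewrite divr_gt0.
  rewrite -wk -uw -vw.
  (* The points were chosen independently, so their order is not known beforehand; the reverse order
     would contradict the monotonicity of [Phi]. *)
  have [uv|vu] := leP (u k) (u k.+1).
    have /dPhi/andP[_] : 0 <= u k <= u k.+1 by rewrite u0. by [].
  have /dPhi/andP[+ _] : 0 <= u k.+1 <= u k by rewrite v0 ltW.
  by rewrite uw vw; lra.
- move=> k kn; have [/andP[u0 uU] _ _] := Hu k kn.
  by rewrite !phim ?lexx ?u0.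
Unshelve. all: by end_near. Qed.

(** * Truncated integrals and partitions adapted to a function *)

Lemma le_min_increment (R : realType) (z u v : R) : u <= v ->
  Num.min z v <= Num.min z u + (v - u) * (u <= z)%R%:R.
Proof.
by move=> uv; case: (leP z v); case: (leP z u); case: (leP u z) => /=; lra.
Qed.

Section truncated_integral.
Context d (T : measurableType d) (R : realType) (mu : {measure set T -> \bar R}).
Context (f : T -> R) (e : R) (mf : measurable_fun setT f)
  (f0 : forall x, 0 <= f x) (e0 : 0 < e)
  (fin_e : (mu [set x | (e <= f x)%R] < +oo)%E).

Local Notation B := [set x | e <= f x].

Lemma measurable_level (r : R) : measurable [set x | r <= f x].
Proof.
have := mf measurableT (measurable_itv `[r, +oo[).
by rewrite setTI; congr measurable; apply/seteqP; split => x /=; rewrite in_itv/= andbT.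
Qed.

Let mB : measurable B := measurable_level e.

(** Cutting off below at [e] and above at [u >= 0] keeps the integral finite, because the level set
    at [e] has finite measure. *)
Definition trunc_integral (u : R) := fine (\int[mu]_(x in B) (Num.min (f x) u)%:E).

(** The maximum with [e] keeps the level set inside the domain of [trunc_integral], so its measure
    is finite; it bounds the slope of [trunc_integral] to the right of [u]. *)
Definition trunc_level (u : R) := fine (mu [set x | Num.max u e <= f x]).

Lemma measurable_min_cst u : measurable_fun B (fun x => (Num.min (f x) u)%:E).
Proof.
apply/measurable_EFinP; apply: measurable_funTS.
by apply: measurable_minr => //; exact: measurable_cst.
Qed.

Lemma trunc_integralE u : 0 <= u ->
  (\int[mu]_(x in B) (Num.min (f x) u)%:E = (trunc_integral u)%:E)%E.
Proof.
move=> u0; rewrite fineK// ge0_fin_numE; last first.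
  by apply: integral_ge0 => x _; rewrite lee_fin le_min f0.
apply: (@le_lt_trans _ _ (\int[mu]_(x in B) (cst u%:E x))%E).
  apply: ge0_le_integral => //.
  - by move=> x _; rewrite lee_fin le_min f0.
  - exact: measurable_min_cst.
  - by move=> x _; rewrite lee_fin ge_min lexx orbT.
by rewrite integral_cst//; apply: lte_mul_pinfty.
Qed.

Lemma trunc_levelE u :
  (mu [set x | (Num.max u e <= f x)%R] = (trunc_level u)%:E)%E.
Proof.
rewrite fineK// ge0_fin_numE//; apply: le_lt_trans fin_e.
apply: le_measure; rewrite ?inE//; first exact: measurable_level.
by move=> x /=; rewrite ge_max => /andP[].
Qed.

Lemma trunc_level_nonincreasing u v : u <= v -> trunc_level v <= trunc_level u.
Proof.
move=> uv; rewrite -lee_fin -!trunc_levelE.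
apply: le_measure; rewrite ?inE; [exact: measurable_level..|].
by move=> x /=; rewrite !ge_max => /andP[/(le_trans uv) -> ->].
Qed.

Lemma trunc_level_le u : ((trunc_level u)%:E <= mu [set x | (u <= f x)%R])%E.
Proof.
rewrite -trunc_levelE; apply: le_measure; rewrite ?inE; [exact: measurable_level..|].
by move=> x /=; rewrite ge_max => /andP[].
Qed.

Lemma trunc_integral0 : trunc_integral 0 = 0.
Proof.
rewrite /trunc_integral integral0_eq// => x _.
by rewrite min_r.
Qed.

(** Integrate [le_min_increment] over the level set at [e]. *)
Lemma trunc_integral_increment u v : 0 <= u <= v ->
  0 <= trunc_integral v - trunc_integral u <= (v - u) * trunc_level u.
Proof.
move=> /andP[u0 uv]; have v0 := le_trans u0 uv.
rewrite subr_ge0 lerBlDl -!lee_fin EFinD EFinM -!trunc_integralE//.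
rewrite -trunc_levelE; apply/andP; split.
  apply: ge0_le_integral => //; try exact: measurable_min_cst.
    by move=> x _; rewrite lee_fin le_min f0.
  by move=> x _; rewrite lee_fin le_min !ge_min lexx uv orbT.
have mI : measurable [set x | u <= f x] := measurable_level u.
have mi : measurable_fun B (fun x => (\1_[set x | u <= f x] x)%:E : \bar R).
  by apply/measurable_EFinP; exact: measurable_indic.
have vu : (0 <= (v - u)%:E :> \bar R)%E by rewrite lee_fin subr_ge0.
have -> : [set x | Num.max u e <= f x] = [set x | u <= f x] `&` B.
  by apply/seteqP; split => x /=; rewrite ge_max => /andP.
rewrite -(integral_indic mu mB mI) -ge0_integralZl//.
have h1 x : B x -> (0 <= (Num.min (f x) u)%:E)%E.
  by move=> _; rewrite lee_fin le_min f0.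
have h2 x : B x -> (0 <= (v - u)%:E * (\1_[set x | (u <= f x)%R] x)%:E)%E.
  by move=> _; rewrite mule_ge0// lee_fin.
have m2 := measurable_funeM (v - u)%:E mi.
rewrite -(ge0_integralD mu mB h1 (measurable_min_cst u) h2 m2).
apply: ge0_le_integral => //.
- by move=> x _; rewrite lee_fin le_min f0.
- exact: measurable_min_cst.
- by apply: emeasurable_funD => //; exact: measurable_min_cst.
- move=> x _; rewrite -EFinM -EFinD lee_fin indicE.
  rewrite (_ : (x \in _) = (u <= f x)); last by apply/idP/idP; rewrite inE.
  exact: le_min_increment.
Qed.

End truncated_integral.

(** Monotone convergence: at each point the truncations, extended by 0, increase and eventually
    equal [f x], namely once [n] exceeds both [f x] and its inverse when [f x] is positive. *)
Lemma trunc_integral_cvg d (T : measurableType d) (R : realType)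
    (mu : {measure set T -> \bar R}) (f : T -> R) :
  measurable_fun setT f -> (forall x, 0 <= f x) ->
  (\int[mu]_(x in [set x | (n.+1%:R^-1 <= f x)%R]) (Num.min (f x) n%:R)%:E
    @[n --> \oo] --> \int[mu]_x (f x)%:E)%E.
Proof.
move=> mf f0.
pose D n := [set x | (n.+1%:R^-1 <= f x)%R].
have mD n : measurable (D n) by exact: measurable_level.
pose g n := (fun x => (Num.min (f x) n%:R)%:E) \_ (D n).
have gE n x : g n x = if n.+1%:R^-1 <= f x then (Num.min (f x) n%:R)%:E else 0%E.
  rewrite /g patchE (_ : (x \in D n) = (n.+1%:R^-1 <= f x))//.
  by apply/idP/idP; rewrite inE.
under eq_fun do rewrite integral_mkcond.
rewrite (_ : (fun x => (f x)%:E) = (fun x => limn (g^~ x))); last first.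
  apply/funext => x; apply/esym/cvg_lim => //; apply: cvg_near_cst.
  have [fx|fx] := leP (f x) 0.
    have {}fx : f x = 0 by apply/eqP; rewrite eq_le fx f0.
    by apply: nearW => n; rewrite gE fx invr_le0 leNgt ltr0n.
  near=> n; rewrite gE ifT ?min_l//.
    by near: n; exact: nbhs_infty_ger.
  rewrite invf_ple ?posrE// (le_trans _ (_ : n%:R <= _))// ?ler_nat//.
  by near: n; exact: nbhs_infty_ger.
apply: cvg_monotone_convergence => //.
- move=> n; apply/(measurable_restrictT _ _).1 => //.
  exact: measurable_min_cst.
- by move=> n x _; rewrite gE; case: ifP => // _; rewrite lee_fin le_min f0/=.
- move=> x _ m n mn; rewrite !gE.
  have mnR : (m%:R <= n%:R :> R) by rewrite ler_nat.
  case: ifPn => [mf'|_]; last by case: ifP => // _; rewrite lee_fin le_min f0/=.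
  rewrite ifT; first by rewrite lee_fin le_min !ge_min lexx mnR orbT.
  by rewrite (le_trans _ mf')// lef_pV2 ?posrE ?ltr0n// ler_nat.
Unshelve. all: by end_near. Qed.

(** Provides the data that [prod_le_of_partition] asks of each factor, with bounds [dK] independent
    of [n]. If some level set has infinite measure, a constant [phi] and a uniform partition
    suffice; otherwise some truncated integral exceeds [y] and [equal_increment_partition]
    applies. *)
Lemma integral_partition d (T : measurableType d) (R : realType)
    (mu : {measure set T -> \bar R}) (f : T -> R) (y : R) :
  measurable_fun setT f -> (forall x, 0 <= f x) ->
  0 < y -> (y%:E < \int[mu]_x (f x)%:E)%E ->
  exists (phi : R -> R) (dK : R * R), [/\ 0 < dK.1,
    forall u, 0 < phi u -> ((phi u)%:E <= mu [set x | (u <= f x)%R])%E &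
    forall n, (0 < n)%N -> exists u : nat -> R,
    [/\ u 0%N = 0,
      forall k, (k < n)%N -> y / n%:R <= (u k.+1 - u k) * phi (u k) &
      forall k, (k <= n)%N -> dK.1 <= phi (u k) <= dK.2]].
Proof.
move=> mf f0 y0 yf.
have [[e e0 fe]|fin] := pselect
    (exists2 e, 0 < e & (mu [set x | (e <= f x)%R] = +oo)%E).
  (* No semi-finiteness is available: mu may have atoms of infinite mass. *)
  exists (fun u => if u <= e then y / e else 0), (y / e, y / e) => /=; split.
  - exact: divr_gt0.
  - move=> u; case: ifPn; rewrite ?ltxx// => ue _.
    apply: (@le_trans _ _ (mu [set x | (e <= f x)%R])); first by rewrite fe leey.
    apply: le_measure; rewrite ?inE; [exact: measurable_level..|].
    by move=> x /=; exact: le_trans.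
  - move=> n n0; have nR : 0 < n%:R :> R by rewrite ltr0n.
    have ue k : (k <= n)%N -> k%:R * e / n%:R <= e.
      by move=> kn; rewrite ler_pdivrMr// mulrC ler_pM2l// ler_nat.
    exists (fun k => k%:R * e / n%:R); split.
    + by rewrite !mul0r.
    + move=> k kn; rewrite ifT ?ue 1?ltnW// -natr1 le_eqVlt; apply/orP; left.
      by apply/eqP; field; rewrite ?gt_eqF.
    + by move=> k kn; rewrite ifT ?ue// lexx.
have {}fin e : 0 < e -> (mu [set x | (e <= f x)%R] < +oo)%E.
  by move=> e0; rewrite ltey; apply/eqP => ?; apply: fin; exists e.
have [n yn] : exists n,
    (y%:E < \int[mu]_(x in [set x | (n.+1%:R^-1 <= f x)%R]) (Num.min (f x) n%:R)%:E)%E.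
  apply/not_existsP => H; move: yf; rewrite ltNge => /negP; apply.
  apply: (cvge_to_le (trunc_integral_cvg mf f0)).
  apply: nearW => n.
  by rewrite leNgt; apply/negP; exact: H.
set e := n.+1%:R^-1 in yn; have e0 : 0 < e :> R by rewrite invr_gt0.
rewrite (trunc_integralE mf f0 (fin _ e0))// lte_fin in yn.
have incr := trunc_integral_increment mf f0 (fin _ e0).
have [d' d0 part] := @equal_increment_partition _ _ (trunc_level mu f e) _ _ y0
  (ler0n R n) (trunc_integral0 mu e f0) yn incr
  (fun u v uv => trunc_level_nonincreasing mf (fin _ e0) (proj2 (andP uv))).
exists (trunc_level mu f e), (d', trunc_level mu f e 0); split => //.
by move=> u _; exact: trunc_level_le (fin _ e0) _.
Qed.

(** * Extended real preliminaries *)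

Lemma lte_dense (R : realType) (x y : \bar R) :
  (x < y)%E -> exists q : R, (x < q%:E < y)%E.
Proof.
case: x y => [x| |] [y| |]//=; rewrite ?lte_fin => xy.
- by exists ((x + y) / 2); rewrite !lte_fin midf_lt// midf_lt.
- by exists (x + 1); rewrite lte_fin ltrDl ltr01 ltry.
- by exists (y - 1); rewrite lte_fin ltrBlDr ltrDl ltr01 ltNyr.
- by exists 0; rewrite ltNyr ltry.
Qed.

(** Extracts real points from the limit of [F] at [a], for finite [a] and for minus infinity
    alike. *)
Lemma nbhs_lte_exists (R : realType) (a : \bar R) (r : R) (U : set (\bar R)) :
  (a < r%:E)%E -> nbhs a U -> exists q : R, (a < q%:E < r%:E)%E /\ U q%:E.
Proof.
case: a => [a| |]//=; rewrite ?lte_fin => ar aU.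
- have {}aU : \forall q \near a, U q%:E by exact: aU.
  near a^'+ => q; exists q; split; first rewrite !lte_fin.
    by apply/andP; split; near: q; [exact: nbhs_right_gt|exact: nbhs_right_lt].
  by near: q; exact: cvg_within.
- have [M [_ UM]] := aU.
  exists (Num.min M r - 1); split; first rewrite ltNyr lte_fin.
    by rewrite ltrBlDr (le_lt_trans (_ : _ <= r))// ?ge_min ?lexx ?orbT// ltrDl.
  by apply: UM; rewrite lte_fin ltrBlDr (le_lt_trans (_ : _ <= M))//
    ?ge_min ?lexx// ltrDl.
Unshelve. all: by end_near. Qed.

Lemma lee_sub_gt0 (R : realType) (x M : \bar R) : x \is a fin_num ->
  (forall e : R, 0 < e -> (x - e%:E <= M)%E) -> (x <= M)%E.
Proof.
move=> xfin H; apply/lee_addgt0Pr => e e0.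
by rewrite -leeBlDr// H.
Qed.

Lemma measurable_oc_itv (R : realType) (a b : \bar R) :
  measurable (oc_itv a b).
Proof.
apply: is_interval_measurable => x y /andP[ax _] /andP[_ yb] z /andP[xz zy].
by rewrite /oc_itv/= (lt_le_trans ax) ?lee_fin// (le_trans _ yb)// lee_fin.
Qed.

(** * Comparison of the Stieltjes measure with the extended [F] *)

Section stieltjes_cdf_theory.
Context (R : realType) (a b : \bar R) (F : R -> R) (hF : stieltjes_fun a b F).
Local Notation cdf := (stieltjes_cdf hF).
Local Notation dF := (stieltjes_measure hF).

Lemma stieltjes_cdf_in r : oc_itv a b r -> cdf r = F r.
Proof.
by move=> /andP[ar rb]; rewrite /stieltjes_cdf min_l// /stieltjes_ext leNgt ar.
Qed.

Lemma stieltjes_cdf_ge0 r : 0 <= cdf r.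
Proof.
rewrite /stieltjes_cdf /stieltjes_ext.
case: (leP (mine r%:E b) a) => // am.
have mb : (mine r%:E b <= b)%E by rewrite ge_min lexx orbT.
have mr : (mine r%:E b <= r%:E)%E by rewrite ge_min lexx.
move: am mb mr; case: (mine _ _) => [q| |]//= aq qb qr.
by apply: (stieltjes_ge0 hF); rewrite /oc_itv/= aq.
Qed.

Lemma stieltjes_cdf_nondecreasing : {homo cdf : r s / r <= s}.
Proof. exact: cumulative_is_nondecreasing. Qed.

Lemma stieltjes_measure_itv x y : x <= y ->
  dF `]x, y]%classic = (cdf y - cdf x)%:E.
Proof.
move=> xy; rewrite /stieltjes_measure /lebesgue_stieltjes_measure.
rewrite /measure_extension/= measurable_mu_extE/=; last exact: is_ocitv.
by rewrite wlength_itv_bnd.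
Qed.

Lemma le_stieltjes_measure (A B : set R) :
  measurable A -> measurable B -> A `<=` B -> (dF A <= dF B)%E.
Proof.
by move=> mA mB AB; exact: (le_measure dF (mem_set mA) (mem_set mB) AB).
Qed.

(** [F] eventually agrees with the monotone function [cdf], whose limit is its supremum. *)
Lemma stieltjes_ext_pinfty : (a < +oo)%E -> b = +oo%E ->
  stieltjes_ext a F +oo%E = ereal_sup (range (fun r => (cdf r)%:E)).
Proof.
move=> aoo boo; rewrite /stieltjes_ext leNgt aoo/=.
have := @nondecreasing_cvge R (fun r => (cdf r)%:E)
  (fun x y xy => stieltjes_cdf_nondecreasing xy).
move=> H; apply/cvg_lim => //; apply: cvg_trans H; apply: near_eq_cvg.
have [q /andP[aq _]] := lte_dense aoo.
near=> r; rewrite stieltjes_cdf_in// /oc_itv/= boo leey andbT (lt_trans aq)//.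
rewrite lte_fin; near: r; apply: nbhs_pinfty_gt; exact: num_real.
Unshelve. all: by end_near. Qed.

Lemma stieltjes_cdf_le_ext r s : (r%:E <= s <= b)%E -> (a < s)%E ->
  ((cdf r)%:E <= stieltjes_ext a F s)%E.
Proof.
case: s => [s| |]// /andP[rs sb] sa.
  rewrite /stieltjes_ext (leNgt s%:E) sa/= lee_fin -(@stieltjes_cdf_in s);
    last by rewrite /oc_itv/= sa.
  by rewrite lee_fin in rs; exact: stieltjes_cdf_nondecreasing.
have boo : b = +oo%E by apply/eqP; rewrite -leye_eq.
by rewrite stieltjes_ext_pinfty//; apply: ereal_sup_ubound; exists r.
Qed.

(** Exhaust the interval by bounded pieces. Each has measure at most an increment of [cdf], hence at
    most a value of [cdf] since [cdf] is nonnegative. *)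
Lemma stieltjes_measure_le_ext s : (s <= b)%E ->
  (dF (oc_itv a s) <= stieltjes_ext a F s)%E.
Proof.
move=> sb; have [sa|sa] := leP s a.
  have -> : oc_itv a s = set0.
    apply/seteqP; split => // r /andP[ar rs].
    by have := lt_le_trans ar (le_trans rs sa); rewrite ltxx.
  by rewrite measure0 /stieltjes_ext sa.
pose S n := oc_itv a s `&` `]- n%:R, n%:R]%classic.
have mS n : measurable (S n).
  by apply: measurableI; [exact: measurable_oc_itv|exact: measurable_itv].
have SE : \bigcup_n S n = oc_itv a s.
  rewrite /S -setI_bigcupr setIidl// => r _.
  exists (Num.truncn `|r|).+1 => //=; rewrite in_itv/=.
  have := truncnS_gt `|r|; rewrite ltr_norml => /andP[-> /ltW]//.
have Sle n : (dF (S n) <= stieltjes_ext a F s)%E.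
  (* The real endpoint [t] is [s] itself when [s] is finite, and [n] when [s] is infinite. *)
  have [t ts St] : exists2 t : R, (t%:E <= s)%E & S n `<=` `]- n%:R, t]%classic.
    move: sa sb @S mS SE; case: s => [s| |]// sa sb S mS SE.
    - exists s => // r [] /andP[_]; rewrite lee_fin => rs /=.
      by rewrite !in_itv/= rs => /andP[->].
    - by exists n%:R; [exact: leey|move=> r []].
    - by rewrite ltNge leNye in sa.
  apply: (@le_trans _ _ (dF `]- n%:R, t]%classic)).
    exact: le_stieltjes_measure.
  have [nt|tn] := leP (- n%:R) t; last first.
    have -> : `]- n%:R, t]%classic = set0.
      by rewrite set_itv_ge// bnd_simp -leNgt ltW.
    rewrite measure0.
    by apply: (le_trans _ (stieltjes_cdf_le_ext (r := t) _ sa));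
      rewrite ?ts ?lee_fin ?stieltjes_cdf_ge0.
  rewrite stieltjes_measure_itv//.
  apply: (le_trans _ (stieltjes_cdf_le_ext (r := t) _ sa)); rewrite ?ts//.
  by rewrite lee_fin lerBlDr lerDl stieltjes_cdf_ge0.
rewrite -SE; apply: (@cvge_to_le _ \oo _ _ (dF \o S)); last exact: nearW.
apply: nondecreasing_cvg_mu => //; first by rewrite SE; exact: measurable_oc_itv.
move=> m n mn; apply/subsetPset; apply: setIS => r/=; rewrite !in_itv/=.
have mnR : (m%:R <= n%:R :> R) by rewrite ler_nat.
by move=> /andP[h1 h2]; apply/andP; split; lra.
Qed.

(** The open interval is enough: [F] vanishes at [a] from the right, and its continuity excludes an
    atom at a finite [s]. This matters because a supremum defining [s] need not be attained. *)
Lemma stieltjes_ext_le_measure s (S : set R) : (s <= b)%E -> measurable S ->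
  (forall r, (a < r%:E < s)%E -> S r) ->
  (stieltjes_ext a F s <= dF S)%E.
Proof.
move=> sb mS aS; have [sa|sa] := leP s a; first by rewrite /stieltjes_ext sa.
have F_le r : (a < r%:E < s)%E -> ((F r)%:E <= dF S)%E.
  move=> /andP[ar rs]; apply: lee_sub_gt0 => // e e0.
  (* Near [a] there is [q] with [F q < e], so []q, r]] already has measure above [F r - e]. *)
  have /cvgrPdist_lt/(_ e e0) := stieltjes_vanish hF.
  rewrite near_withinE => /(nbhs_lte_exists ar)[q [/andP[aq qr] H]].
  have qs := lt_trans qr rs.
  have qab : oc_itv a b q by rewrite /oc_itv/= aq (le_trans (ltW qs)).
  have rab : oc_itv a b r by rewrite /oc_itv/= ar (le_trans (ltW rs)).
  have Fqe : F q < e.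
    have := H qab; rewrite sub0r normrN; exact/le_lt_trans/ler_norm.
  apply: (@le_trans _ _ (dF `]q, r]%classic)).
    rewrite stieltjes_measure_itv; last by rewrite -lee_fin ltW.
    by rewrite !stieltjes_cdf_in// lee_fin lerB// ltW.
  apply: le_stieltjes_measure => //.
  move=> x /=; rewrite in_itv/= => /andP[qx xr]; apply: aS.
  rewrite (lt_trans aq) ?lte_fin//=; apply: le_lt_trans rs.
  by rewrite lee_fin.
move: sa sb aS F_le; case: s => [s| |]// sa sb aS F_le.
(* Finite [s]: approach it from the left, where [F r] is within [e] of [F s]. *)
- rewrite /stieltjes_ext (leNgt s%:E) sa/=; apply: lee_sub_gt0 => // e e0.
  have sab : oc_itv a b s by rewrite /oc_itv/= sa.
  have /subspace_continuousP/(_ s sab)/cvgrPdist_lt/(_ e e0) :=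
    stieltjes_continuous hF.
  rewrite near_withinE => H.
  have [q /andP[aq qs]] := lte_dense sa.
  near s^'- => r.
  have qr : q < r by near: r; apply: nbhs_left_gt; rewrite -lte_fin.
  have ar : (a < r%:E)%E by rewrite (lt_trans aq).
  have rs : r < s by near: r; exact: nbhs_left_lt.
  have rab : oc_itv a b r by rewrite /oc_itv/= ar (le_trans _ sb)// lee_fin ltW.
  apply: (le_trans _ (F_le r _)); last by rewrite ar lte_fin.
  rewrite lee_fin lerBlDr -lerBlDl (le_trans (ler_norm _))// ltW//.
  suff : oc_itv a b r -> `|F s - F r| < e by exact.
  by near: r; exact: cvg_within.
- have boo : b = +oo%E by apply/eqP; rewrite -leye_eq.
  rewrite stieltjes_ext_pinfty//; apply: ge_ereal_sup => _ [r _ <-].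
  have [q /andP[aq _]] := lte_dense sa.
  (* Taking the maximum with [q] moves the point into (a, b], where [cdf] and [F] agree. *)
  have am : (a < (Num.max r q)%:E)%E.
    by rewrite (lt_le_trans aq)// lee_fin le_max lexx orbT.
  apply: (le_trans _ (F_le (Num.max r q) _)); last by rewrite am ltry.
  rewrite -stieltjes_cdf_in; last by rewrite /oc_itv/= am boo leey.
  by rewrite lee_fin stieltjes_cdf_nondecreasing// le_max lexx.
- by rewrite ltNge leNye in sa.
Unshelve. all: by end_near. Qed.

End stieltjes_cdf_theory.

(** * Products of powers in the extended reals *)

Lemma lee_prod (R : realType) (I : finType) (x y : I -> \bar R) :
  (forall i, 0 <= x i <= y i)%E -> (\prod_i x i <= \prod_i y i)%E.
Proof.
move=> xy.
suff : (0 <= \prod_i x i <= \prod_i y i)%E by case/andP.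
elim/big_ind2 : _ => [|x1 x2 y1 y2 /andP[a b] /andP[a' b']|i _ //].
  by rewrite lee01 lexx.
by rewrite mule_ge0//= lee_pmul.
Qed.

Lemma lee_prod_poweR (R : realType) (I : finType) (l : I -> R)
    (x y : I -> \bar R) : (forall i, 0 <= l i) -> (forall i, 0 <= x i <= y i)%E ->
  (\prod_i x i `^ l i <= \prod_i y i `^ l i)%E.
Proof.
move=> l0 xy; apply: lee_prod => i; have /andP[x0 xyi] := xy i.
rewrite poweR_ge0/=; apply: gt0_ler_poweR => //.
  by rewrite in_itv/= x0 leey.
by rewrite in_itv/= (le_trans x0 xyi) leey.
Qed.

Lemma prod_poweR_eq0 (R : realType) (I : finType) (l : I -> R)
    (x : I -> \bar R) i : l i != 0 -> x i = 0%E ->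
  (\prod_i x i `^ l i = 0)%E.
Proof.
by move=> li xi; rewrite (bigD1 i)//= xi poweR_EFin powR0// mul0e.
Qed.

Lemma ler_of_lt1_scale (R : realType) (s j : R) : 0 <= j ->
  (forall t, 0 < t < 1 -> t * s <= j) -> s <= j.
Proof.
move=> j0 H; rewrite leNgt; apply/negP => js.
have s0 : 0 < s by exact: le_lt_trans js.
have ss : 0 < s + s by lra.
(* This value of [t] makes [t * s] the midpoint of [j] and [s], which exceeds [j]. *)
have : (j + s) / (s + s) * s <= j.
  apply: H; apply/andP; split; first by rewrite divr_gt0//; lra.
  by rewrite ltr_pdivrMr//; lra.
rewrite mulrAC ler_pdivrMr//; nra.
Qed.

(** Replaces possibly infinite integrals by positive reals strictly below them. When all factors are
    positive and finite, scaling every one by [t < 1] scales the product by [t], as the weights sum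
    to 1. *)
Lemma prod_poweR_le_sup (R : realType) (I : finType) (l : I -> R)
    (x : I -> \bar R) (j : R) :
  (forall i, 0 < l i) -> \sum_i l i = 1 -> (forall i, 0 <= x i)%E -> 0 <= j ->
  (forall y : I -> R, (forall i, 0 < y i) -> (forall i, (y i)%:E < x i)%E ->
    \prod_i y i `^ l i <= j) ->
  (\prod_i x i `^ l i <= j%:E)%E.
Proof.
move=> l0 l1 x0 j0 H.
have [/existsP[i /eqP xi]|/existsPn xN] := boolP [exists i, x i == 0%E].
  by rewrite (@prod_poweR_eq0 _ _ _ _ i) ?gt_eqF// lee_fin.
have {xN x0}x0 i : (0 < x i)%E by rewrite lt_neqAle eq_sym xN x0.
have [/existsP[i /eqP xi]|/existsPn xN] := boolP [exists i, x i == +oo%E].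
  have /choice[y0 Hy0] : forall k, exists q : R, (0 < q%:E < x k)%E.
    by move=> k; exact: lte_dense.
  have y00 k : 0 < y0 k by have /andP[+ _] := Hy0 k; rewrite lte_fin.
  pose c := \prod_(k | k != i) y0 k `^ l k.
  have c0 : 0 < c by apply: prodr_gt0 => k _; rewrite powR_gt0.
  (* With this value in the infinite coordinate the product becomes [j + 1], contradicting the bound
     [j]. *)
  pose M := ((j + 1) / c) `^ (l i)^-1.
  have jc : 0 < (j + 1) / c by rewrite divr_gt0// ltr_wpDl.
  pose y k := if k == i then M else y0 k.
  have : \prod_k y k `^ l k <= j.
    apply: H => k; rewrite /y; have [ki|_] := eqVneq k i => //.
    - by rewrite powR_gt0.
    - by rewrite ki xi ltry.
    - by have /andP[] := Hy0 k.
  rewrite (bigD1 i)//= {1}/y eqxx.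
  have -> : \prod_(k | k != i) y k `^ l k = c.
    by apply: eq_bigr => k ki; rewrite /y (negbTE ki).
  rewrite -powRrM mulVf ?gt_eqF// powRr1; last exact: ltW.
  by rewrite divfK ?gt_eqF// leNgt ltrDl ltr01.
have xE i : x i = (fine (x i))%:E.
  by rewrite fineK// ge0_fin_numE ?ltW// ltey.
have fx0 i : 0 < fine (x i) by rewrite -lte_fin -xE.
under eq_bigr do rewrite xE poweR_EFin.
rewrite prodEFin lee_fin; apply: ler_of_lt1_scale => // t /andP[t0 t1].
rewrite -{1}(prod_powR_cst t0 l1) -prod_powRM; last 2 first.
  by move=> _; exact: ltW.
  by move=> i; exact: ltW.
apply: H => i; first exact: mulr_gt0.
by rewrite [ltRHS]xE lte_fin gtr_pMl.
Qed.

(** * Lower sums and level sets *)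

Lemma integral_lower_sum d (T : measurableType d) (R : realType)
    (mu : {measure set T -> \bar R}) (D : set T) (g : T -> R) (n : nat)
    (w p : nat -> R) :
  measurable D -> measurable_fun D g -> (forall x, D x -> 0 <= g x) ->
  0 <= w 0%N -> (forall k, (k < n)%N -> w k <= w k.+1) ->
  (forall k, (k < n)%N ->
    ((p k.+1)%:E <= mu (D `&` [set x | (w k.+1 <= g x)%R]))%E) ->
  ((\sum_(0 <= k < n) (w k.+1 - w k) * p k.+1)%:E
    <= \int[mu]_(x in D) (g x)%:E)%E.
Proof.
move=> mD mg g0 w0 wm pmu.
pose A (k : 'I_n) := D `&` [set x | (w k.+1 <= g x)%R].
have mA k : measurable (A k).
  have := mg mD _ (measurable_itv `[w k.+1, +oo[).
  by congr measurable; apply/seteqP; split => x /= []; rewrite in_itv/= ?andbT.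
have dw (k : 'I_n) : 0 <= w k.+1 - w k by rewrite subr_ge0 wm.
have mI k : measurable_fun D (fun x => (\1_(A k) x)%:E : \bar R).
  by apply/measurable_EFinP; exact: measurable_indic.
pose h (k : 'I_n) x := ((w k.+1 - w k)%:E * (\1_(A k) x)%:E)%E.
have mh k : measurable_fun D (h k) by exact: measurable_funeM.
have h0 k x : D x -> (0 <= h k x)%E by move=> _; rewrite mule_ge0// lee_fin.
apply: (@le_trans _ _ (\int[mu]_(x in D) \sum_(k < n) h k x)%E).
  rewrite ge0_integral_sum// big_mkord -sumEFin; apply: lee_sum => k _.
  rewrite ge0_integralZl// ?lee_fin//.
  rewrite integral_indic// EFinM lee_wpmul2l ?lee_fin//.
  by rewrite setIidl; [exact: pmu|move=> x []].
apply: ge0_le_integral => //.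
- by move=> x Dx; apply: sume_ge0 => k _; exact: h0.
- exact: emeasurable_sum.
- exact/measurable_EFinP.
move=> x Dx; rewrite /h; under eq_bigr do rewrite -EFinM.
(* Pointwise, the layers lying below [g x] add up to at most [g x]. *)
rewrite sumEFin lee_fin; apply: le_trans (lower_sum_le w0 wm (g0 x Dx)).
rewrite big_mkord; apply: ler_sum => k _; rewrite ler_wpM2l// indicE.
rewrite (_ : (x \in A k) = (w k.+1 <= g x)%R)//.
by apply/idP/idP => [|?]; rewrite inE/A/=; [case|split].
Qed.

(** Membership in [C] holds only at almost every level, but []v, u[] has positive Lebesgue measure.
    Its levels lie below the essential supremum because the level set at [u] has positive
    measure. *)
Lemma level_class_exists d (T : measurableType d) (R : realType)
    (mu : {measure set T -> \bar R}) (C : set (set T)) (f : T -> R) (v u : R) :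
  level_class mu C f -> 0 <= v < u -> (0 < mu [set x | (u <= f x)%R])%E ->
  exists2 t, v < t < u & C [set x | t <= f x].
Proof.
move=> [mf f0 [N [mN N0 HN]]] /andP[v0 vu] mu0.
apply/not_exists2P => HC.
have : (@lebesgue_measure R `]v, u[%classic <= lebesgue_measure N)%E.
  apply: le_measure; rewrite ?inE// => t tvu; apply: HN => /= HN.
  move: tvu; rewrite /= in_itv/= => tvu.
  have [tC|] := HC t; first by rewrite tvu in tC.
  have /andP[vt tu] := tvu.
  apply; apply: HN; first exact: le_lt_trans vt.
  rewrite ltNge; apply/negP => Nt.
  (* The essential supremum norm is defined by cases on the total mass, whose positivity selects the
     right branch. *)
  have muT : (0 < mu [set: T])%E.
    apply: lt_le_trans mu0 _; apply: le_measure; rewrite ?inE//.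
    exact: measurable_level.
  move: Nt; rewrite unlock muT => /ess_supP[M [mM M0 HM]].
  have : (mu [set x | (u <= f x)%R] <= mu M)%E.
    apply: le_measure; rewrite ?inE//; first exact: measurable_level.
    move=> x /= ux; apply: HM => /=; rewrite lee_fin ger0_norm//.
    by apply/negP; rewrite -ltNge (lt_le_trans tu).
  by rewrite M0 leNgt mu0.
by rewrite N0 lebesgue_measure_itv/= lte_fin vu -EFinD lee_fin subr_le0 leNgt vu.
Qed.

(** The norm of the indicator is at most 1, and every level in ]0, 1] cuts out [A] itself. *)
Lemma level_class_indic d (T : measurableType d) (R : realType)
    (mu : {measure set T -> \bar R}) (C : set (set T)) (A : set T) :
  measurable A -> C A -> level_class mu C (\1_A : T -> R).
Proof.
move=> mA CA; split; [exact: measurable_indic|by []|].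
apply: nearW => r r0 rN.
suff -> : [set x | r <= \1_A x] = A by [].
have r1 : r <= 1.
  rewrite -lee_fin; apply: le_trans (ltW rN) _.
  rewrite unlock; case: ifP => _ //.
  apply/ess_supP; apply: nearW => x /=.
  by rewrite lee_fin indicE; case: (_ \in _); rewrite ?normr1 ?normr0.
apply/seteqP; split => x /=; rewrite indicE.
  by case: (boolP (x \in A)); rewrite ?inE// leNgt r0.
by move=> Ax; rewrite mem_set.
Qed.

Unset Implicit Arguments.

(** * From the inequality for sets to the inequality for functions *)

Section level_product.
Context (R : realType) (m : nat) (X : 'I_m -> polishMetricType R)
    (mu : forall i, {measure set (borelType (X i)) -> \bar R})
    (c : prod_topology X -> R) (l : 'I_m -> R)
    (C : forall i, set (set (borelType (X i))))
    (a b : \bar R) (F : R -> R) (hF : stieltjes_fun a b F).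
Context (l0 : forall i, 0 < l i) (l1 : \sum_i l i = 1)
  (hab : forall A : forall i, set (X i),
      (forall i, C i (A i)) -> (forall i, A i !=set0) ->
      (a <= sup_neg c A <= b)%E)
  (H : forall A : forall i, set (X i),
      (forall i, C i (A i)) -> (forall i, A i !=set0) ->
      (\prod_(i < m) mu i (A i) `^ l i <= stieltjes_ext a F (sup_neg c A))%E).
Context (f : forall i, X i -> R) (Omega : R -> R).
Context (hf : forall i, level_class (mu i) (C i) (f i))
  (mOmega : measurable_fun (oc_itv a b) Omega)
  (Omega0 : forall r, oc_itv a b r -> 0 <= Omega r)
  (Omegam : {in oc_itv a b &, {homo Omega : r s / r <= s >-> s <= r}})
  (fOmega : forall x : prod_topology X, oc_itv a b (- c x) ->
         \prod_(i < m) f i (x i) `^ l i <= Omega (- c x)).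

(** Apply the set inequality to level sets of [f i] at levels [v i] between [t * u i] and [u i]. The
    factor [t < 1] leaves room for choosing levels whose sets belong to [C i]. *)
Lemma prod_level_le (u : 'I_m -> R) (t : R) : (forall i, 0 < u i) ->
  (forall i, 0 < mu i [set x | (u i <= f i x)%R])%E -> 0 < t < 1 ->
  (\prod_(i < m) mu i [set x | (u i <= f i x)%R] `^ l i <=
   stieltjes_measure hF (oc_itv a b `&`
     [set r | (t * (\prod_(i < m) u i `^ l i) <= Omega r)%R]))%E.
Proof.
move=> u0 muu /andP[t0 t1].
have /choice[v Hv] : forall i, exists v, t * u i < v < u i /\ C i [set x | v <= f i x].
  move=> i; have [|v] := level_class_exists (v := t * u i) (hf i) _ (muu i).
    by rewrite mulr_ge0 ?ltW//= gtr_pMl.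
  by exists v.
pose A i : set (X i) := [set x | v i <= f i x].
have CA i : C i (A i) by have [] := Hv i.
have uA i : [set x | u i <= f i x] `<=` A i.
  by move=> x /=; have [/andP[_ /ltW vu] _] := Hv i; exact: le_trans.
have mf i : measurable_fun setT (f i : borelType (X i) -> R) by have [] := hf i.
have A0 i : A i !=set0.
  have [x xu] : [set x | u i <= f i x] !=set0.
    by apply/set0P/eqP => u_eq0; have := muu i; rewrite u_eq0 measure0 ltxx.
  by exists x; exact: uA.
have /andP[sa sb] := hab _ CA A0.
apply: (@le_trans _ _ (\prod_(i < m) mu i (A i) `^ l i)%E).
  apply: lee_prod_poweR => i; first exact: ltW.
  rewrite measure_ge0/=; apply: le_measure; rewrite ?inE.
  - exact: (measurable_level (mf i)).
  - exact: (measurable_level (mf i)).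
  - exact: uA.
apply: le_trans (H _ CA A0) _.
apply: stieltjes_ext_le_measure => //.
  rewrite (_ : [set r | _] = Omega @^-1` `[t * \prod_(i < m) u i `^ l i, +oo[).
    exact: mOmega (measurable_oc_itv a b) _ (measurable_itv _).
  by apply/seteqP; split => x /=; rewrite in_itv/= andbT.
(* Below the supremum there is [x] in the product of the [A i] with [r < - c x]; then
   [Omega r >= Omega (- c x)], which dominates the product of the [f i (x i)], hence that of the
   [t * u i]. *)
move=> r /andP[ar /ereal_sup_gt[_ [x Ax <-]]]; rewrite lte_fin => rx.
have xb : ((- c x)%:E <= b)%E.
  by apply: le_trans sb; apply: ereal_sup_ubound; exists x.
have rab : oc_itv a b r.
  by rewrite /oc_itv/= ar (le_trans _ xb)// lee_fin ltW.
have xab : oc_itv a b (- c x).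
  by rewrite /oc_itv/= xb (lt_trans ar).
split => //=.
apply: (@le_trans _ _ (Omega (- c x))); last first.
  by apply: Omegam; rewrite ?inE// ltW.
apply: le_trans (fOmega _ xab).
rewrite -{1}(prod_powR_cst t0 l1) -prod_powRM => [|i|i]; [|exact: ltW..].
apply: ler_prod_powR => i; first exact: ltW.
have [/andP[/ltW tv _] _] := Hv i.
by rewrite (le_trans tv (Ax i)) andbT mulr_ge0// ltW.
Qed.

Lemma prod_integral_le :
  (\prod_(i < m) (\int[mu i]_x (f i x)%:E) `^ l i
        <= \int[stieltjes_measure hF]_(r in oc_itv a b) (Omega r)%:E)%E.
Proof.
have mf i : measurable_fun setT (f i : borelType (X i) -> R) by have [] := hf i.
have f0 i x : 0 <= f i x by have [] := hf i.
have : (0 <= \int[stieltjes_measure hF]_(r in oc_itv a b) (Omega r)%:E)%E.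
  by apply: integral_ge0 => r rab; rewrite lee_fin Omega0.
case Jj : (\int[_]_(_ in _) _)%E => [j| |] // j0; last by rewrite leey.
apply: prod_poweR_le_sup => //.
  by move=> i; apply: integral_ge0 => x _; rewrite lee_fin.
move=> y y0 yI.
have /choice[phi /choice[dK P]] i := integral_partition (mf i) (f0 i) (y0 i) (yI i).
apply: (@prod_le_of_partition _ _ l y phi (fun i => (dK i).1) (fun i => (dK i).2)) => //.
- by move=> i; have [] := P i.
- by move=> i; have [] := P i.
(* Scaling by [t < 1] absorbs the loss in [prod_level_le]; the lower sum for [Omega] is taken along
   [t] times the geometric means of the partition points. *)
move=> n u u0 um phi0; apply: ler_of_lt1_scale => // t t01.
have t0 : 0 < t by case/andP: t01.
have u_ge0 k i : (k <= n)%N -> 0 <= u k i.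
  elim: k => [_|k ih kn]; first by rewrite u0.
  by rewrite (le_trans (ih (ltnW kn)))// ltW// um.
have u_gt0 k i : (k < n)%N -> 0 < u k.+1 i.
  by move=> kn; exact: le_lt_trans (u_ge0 k i (ltnW kn)) (um i k kn).
rewrite mulr_sumr; under eq_bigr do rewrite mulrA mulrBr.
rewrite -lee_fin -Jj.
apply: (@integral_lower_sum _ _ _ _ _ _ _
  (fun k => t * \prod_(i < m) u k i `^ l i)
  (fun k => \prod_(i < m) phi i (u k i) `^ l i)) => //.
- exact: measurable_oc_itv.
- by rewrite mulr_ge0 ?prod_powR_ge0// ltW.
- move=> k kn; apply: ler_wpM2l; first exact: ltW.
  apply: ler_prod_powR => i; first exact: ltW.
  by rewrite (u_ge0 k i (ltnW kn))/= ltW// um.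
move=> k kn.
have phi_le i : ((phi i (u k.+1 i))%:E <= mu i [set x | (u k.+1 i <= f i x)%R])%E.
  by have [_ + _] := P i; apply; exact: phi0.
have phi0' i : (0 < (phi i (u k.+1 i))%:E)%E by rewrite lte_fin phi0.
apply: le_trans (prod_level_le _ _ _ _ t01).
- rewrite -prodEFin; under eq_bigr do rewrite -poweR_EFin.
  apply: lee_prod_poweR => i; first exact: ltW.
  by rewrite phi_le andbT ltW.
- by move=> i; exact: u_gt0.
- by move=> i; exact: lt_le_trans (phi_le i).
Qed.

End level_product.

Theorem lemma1p2 (R : realType) (m : nat) (X : 'I_m -> polishMetricType R)
    (mu : forall i, {measure set (borelType (X i)) -> \bar R})
    (c : prod_topology X -> R) (hc : continuous c)
    (lambda : 'I_m -> R) (hlambda : forall i, 0 < lambda i < 1)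
    (sum_lambda : \sum_(i < m) lambda i = 1)
    (C : forall i, set (set (borelType (X i))))
    (hC : forall i, C i `<=` measurable)
    (a b : \bar R)
    (hab : forall A : forall i, set (X i),
      (forall i, C i (A i)) -> (forall i, A i !=set0) ->
      (a <= sup_neg c A <= b)%E)
    (F : R -> R) (hF : stieltjes_fun a b F) :
  (forall A : forall i, set (X i),
      (forall i, C i (A i)) -> (forall i, A i !=set0) ->
      (\prod_(i < m) mu i (A i) `^ lambda i <= stieltjes_ext a F (sup_neg c A))%E)
  <->
  (forall f : forall i, X i -> R,
      (forall i, level_class (mu i) (C i) (f i)) ->
    forall Omega : R -> R,
      measurable_fun (oc_itv a b) Omega ->
      (forall r, oc_itv a b r -> 0 <= Omega r) ->
      {in oc_itv a b &, {homo Omega : r s / r <= s >-> s <= r}} ->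
      (forall x : prod_topology X, oc_itv a b (- c x) ->
         \prod_(i < m) f i (x i) `^ lambda i <= Omega (- c x)) ->
      (\prod_(i < m) (\int[mu i]_x (f i x)%:E) `^ lambda i
        <= \int[stieltjes_measure hF]_(r in oc_itv a b) (Omega r)%:E)%E).
Proof.
have l0 i : 0 < lambda i by case/andP: (hlambda i).
split=> [H f hf Omega mO O0 Om fO|H A CA A0].
  exact: (prod_integral_le _ _ _ mu c lambda C a b F hF l0 sum_lambda hab H).
have /andP[_ sb] := hab A CA A0.
set s := sup_neg c A in sb *.
have mA i : measurable (A i : set (borelType (X i))) by exact: hC.
have mS : measurable (oc_itv -oo%E s : set R) by exact: measurable_oc_itv.
(* Converse: test with the indicators of the [A i] and, for [Omega], the indicator of the half-line
   up to [s], whose integral is the measure of (a, s]. *)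
have := H (fun i => (\1_(A i) : X i -> R))
  (fun i => level_class_indic (mu i) (mA i) (CA i)) (\1_(oc_itv -oo%E s)).
rewrite integral_indic//; last exact: measurable_oc_itv.
have -> : oc_itv -oo%E s `&` oc_itv a b = oc_itv a s.
  apply/seteqP; split => r /=.
    by move=> [/andP[_ rs] /andP[ar _]]; apply/andP.
  move=> /andP[ar rs]; split; first by rewrite /oc_itv/= ltNyr.
  by rewrite /oc_itv/= ar (le_trans rs).
under eq_bigr do rewrite integral_indic// setIT.
move=> H'; apply: le_trans (stieltjes_measure_le_ext hF sb); apply: H'.
- exact: measurable_indic.
- by [].
- move=> r r' _ _ rr'; rewrite !indicE.
  have [|_] := boolP (r' \in oc_itv -oo%E s); last by case: (_ \in _).
  rewrite inE => /andP[_ r's]; rewrite mem_set// /oc_itv/= ltNyr/=.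
  by apply: le_trans r's; rewrite lee_fin.
move=> x _.
(* If every [x i] lies in [A i], then [- c x <= s] and both sides are 1; otherwise a factor, hence
   the left side, vanishes. *)
have [xA|/existsNP[i xA]] := pselect (forall i, A i (x i)).
  rewrite [X in X <= _]big1 => [|i _]; last by rewrite indicE mem_set// powR1.
  rewrite indicE mem_set// /oc_itv/= ltNyr/=.
  by apply: ereal_sup_ubound; exists x.
rewrite (@prod_powR_eq0 _ _ _ _ i) ?gt_eqF// indicE.
by apply/eqP; rewrite pnatr_eq0 eqb0; apply/negP; rewrite inE.
Qed.
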